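(* There is an absolute constant $C>0$ such that for all integers $T\ge 2$ and $d\ge 1$ there exists an efficient forecasting algorithm for the $T$-round online protocol with context space $\mathcal X=\{x\in\mathbb R^d:\|x\|_2\le 1,\ x_1=\tfrac12\}$ (making predictions in $\mathcal Z=\{0,\frac1N,\dots,\frac{N-1}{N},1\}$ for a suitable positive integer $N$ chosen by the algorithm) such that, for every oblivious adversary and every $\delta\in(0,1)$, with probability at least $1-\delta$, $$\mathsf{SMCal}_{\mathcal F_1^{\mathrm{lin}},2}\le C\left(T^{\frac13}d^{\frac23}(\log T)^{\frac23}+\left(\frac{T}{d\log T}\right)^{\frac13}\log\frac1\delta\right).$$ Furthermore, $\mathbb E\big[\mathsf{SMCal}_{\mathcal F_1^{\mathrm{lin}},2}\big]\le C\,T^{\frac13}d^{\frac23}(\log T)^{\frac23}$, where the expectation is over the internal randomness of the algorithm.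
   Context: Online protocol. There are $T$ rounds ($T$ known). An oblivious adversary fixes a sequence $(x_1,y_1),\dots,(x_T,y_T)\in\mathcal X\times\{0,1\}$ in advance (knowing the forecaster's algorithm but not its random draws). In round $t$: the context $x_t$ is revealed; the forecaster chooses a distribution $\mathcal P_t$ on $\mathcal Z$ and draws a prediction $p_t\sim\mathcal P_t$; then $y_t$ is revealed. Function class. $\mathcal F^{\mathrm{lin}}=\{x\mapsto\langle\theta,x\rangle:\theta\in\mathbb R^d\}$ and $\mathcal F_1^{\mathrm{lin}}=\{f\in\mathcal F^{\mathrm{lin}}: f(x)^2\le 1\ \text{for all }x\in\mathcal X\}$. Swap multicalibration. For $p\in\mathcal Z$ and $f:\mathcal X\to\mathbb R$ let $$\rho_{p,f}=\frac{\sum_{t=1}^T\mathbb I[p_t=p]\,f(x_t)(y_t-p)}{\sum_{t=1}^T\mathbb I[p_t=p]}$$ (with value $0$ if the denominator is $0$). For $q\ge 1$, the $\ell_q$-swap multicalibration error is $$\mathsf{SMCal}_{\mathcal F,q}=\sum_{p\in\mathcal Z}\Big(\sum_{t=1}^T\mathbb I[p_t=p]\Big)\sup_{f\in\mathcal F}|\rho_{p,f}|^q .$$ ''Efficient'' means running time polynomial in $T$ and $d$. *)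

(* Defs.v *)
From HB Require Import structures.
From mathcomp Require Import all_boot all_order all_algebra.
From mathcomp Require Import all_classical all_reals all_analysis.

Set Implicit Arguments.
Unset Strict Implicit.
Unset Printing Implicit Defensive.

Import Order.TTheory GRing.Theory Num.Theory.

Local Open Scope ring_scope.

(** * Machine model

    Algorithms are programs of a real RAM.  The memory consists of
    two-dimensional arrays, named by natural numbers: one family of arrays
    holds natural numbers (counters, indices), the other holds exact real
    numbers.  The unit-cost operations are [+] and truncated [-] on naturals,
    the four field operations on reals (with [u / 0 = 0]), the embedding of
    naturals into reals, comparisons, and array accesses.  There is no rounding
    of reals to integers and there are no real constants, so a program is a
    finite object that does not depend on the real numbers, and that cannot
    hide any computation in its constants. *)

Inductive iexpr : Type :=
| ICst of nat
| IGet of nat & iexpr & iexpr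
| IAdd of iexpr & iexpr
| ISub of iexpr & iexpr.

Inductive rexpr : Type :=
| RNat of iexpr
| RGet of nat & iexpr & iexpr
| RAdd of rexpr & rexpr
| RSub of rexpr & rexpr
| RMul of rexpr & rexpr
| RDiv of rexpr & rexpr.

Inductive test : Type :=
| ILt of iexpr & iexpr
| RLt of rexpr & rexpr.

(** [SetI a i j e] is the assignment [a[i, j] := e].  [For a e c] evaluates the
    number [n] of iterations [e] once, and then runs [c] for
    [a[0, 0] = 0, ..., n - 1]; hence every program terminates. *)
Inductive cmd : Type :=
| Skip
| SetI of nat & iexpr & iexpr & iexpr
| SetR of nat & iexpr & iexpr & rexpr
| Seq of cmd & cmd
| If of test & cmd & cmd
| For of nat & iexpr & cmd.

Record store (R : Type) : Type := Store {
  ints : nat -> nat -> nat -> nat;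
  reals : nat -> nat -> nat -> R
}.

Definition upd (V : Type) (h : nat -> nat -> nat -> V) (a i j : nat) (v : V) :
    nat -> nat -> nat -> V :=
  fun a' i' j' => if [&& a' == a, i' == i & j' == j] then v else h a' i' j'.

Definition set_int (R : Type) (m : store R) (a i j n : nat) : store R :=
  Store (upd (ints m) a i j n) (reals m).

Definition set_real (R : Type) (m : store R) (a i j : nat) (r : R) : store R :=
  Store (ints m) (upd (reals m) a i j r).

Fixpoint ieval (R : Type) (m : store R) (e : iexpr) : nat :=
  match e with
  | ICst n => n
  | IGet a i j => ints m a (ieval m i) (ieval m j)
  | IAdd e1 e2 => (ieval m e1 + ieval m e2)%N
  | ISub e1 e2 => (ieval m e1 - ieval m e2)%N
  end.

Fixpoint reval (R : realType) (m : store R) (e : rexpr) : R :=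
  match e with
  | RNat n => (ieval m n)%:R
  | RGet a i j => reals m a (ieval m i) (ieval m j)
  | RAdd e1 e2 => reval m e1 + reval m e2
  | RSub e1 e2 => reval m e1 - reval m e2
  | RMul e1 e2 => reval m e1 * reval m e2
  | RDiv e1 e2 => reval m e1 / reval m e2
  end.

Definition teval (R : realType) (m : store R) (b : test) : bool :=
  match b with
  | ILt e1 e2 => (ieval m e1 < ieval m e2)%N
  | RLt e1 e2 => reval m e1 < reval m e2
  end.

Fixpoint exec (R : realType) (c : cmd) (m : store R) : store R :=
  match c with
  | Skip => m
  | SetI a i j e => set_int m a (ieval m i) (ieval m j) (ieval m e)
  | SetR a i j e => set_real m a (ieval m i) (ieval m j) (reval m e)
  | Seq c1 c2 => exec c2 (exec c1 m)
  | If b c1 c2 => if teval m b then exec c1 m else exec c2 m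
  | For a e c1 =>
      iteri (ieval m e) (fun i m' => exec c1 (set_int m' a 0 0 i)) m
  end.

Fixpoint isize (e : iexpr) : nat :=
  match e with
  | ICst _ => 1
  | IGet _ e1 e2 | IAdd e1 e2 | ISub e1 e2 => (isize e1 + isize e2).+1
  end.

Fixpoint rsize (e : rexpr) : nat :=
  match e with
  | RNat e1 => (isize e1).+1
  | RGet _ e1 e2 => (isize e1 + isize e2).+1
  | RAdd e1 e2 | RSub e1 e2 | RMul e1 e2 | RDiv e1 e2 =>
      (rsize e1 + rsize e2).+1
  end.

Definition test_size (b : test) : nat :=
  match b with
  | ILt e1 e2 => (isize e1 + isize e2).+1
  | RLt e1 e2 => (rsize e1 + rsize e2).+1
  end.

(** Number of elementary operations performed by [c] when started in [m]. *)
Fixpoint cost (R : realType) (c : cmd) (m : store R) : nat :=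
  match c with
  | Skip => 1
  | SetI _ i j e => (isize i + isize j + isize e).+1
  | SetR _ i j e => (isize i + isize j + rsize e).+1
  | Seq c1 c2 => (cost c1 m + cost c2 (exec c1 m)).+1
  | If b c1 c2 => (test_size b + if teval m b then cost c1 m else cost c2 m).+1
  | For a e c1 =>
      (isize e + \sum_(n < ieval m e)
         (cost c1 (set_int
            (iteri n (fun i m' => exec c1 (set_int m' a 0 0 i)) m)
            a 0 0 n)).+1).+1
  end.

(** * Forecasting algorithms

    A forecasting algorithm consists of two programs, the same for all [T] and
    [d].  [setup] computes the size of the prediction grid from [T] and [d].
    [round] computes the distribution of the prediction of the current round
    from the history of the play.  The randomness of the algorithm is that of
    the draws of the predictions from these distributions. *)

Record algorithm : Type := Algorithm { setup : cmd; round : cmd }.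

(** Input arrays: [params[0, _]] contains [T], [d], [N] and the number [t] of
    the current round ([N] and [t] being [0] in the setup phase);
    [contexts[s, i]] is the [i]-th coordinate of the context of round [s];
    [labels[s, 0]] is the label of round [s]; [draws[s, 0]] is the [k] such that
    the prediction of round [s] was [k / N].  Rounds and coordinates are
    numbered from [0].  Output arrays: [size_out[0, 0]] is the size of the grid;
    [weights[k, 0]] is the probability of the prediction [k / N]. *)
Definition params : nat := 0.
Definition labels : nat := 1.
Definition draws : nat := 2.
Definition size_out : nat := 3.
Definition contexts : nat := 0.
Definition weights : nat := 1.

Definition pad (n : nat) (V : Type) (v0 : V) (f : 'I_n -> V) (i : nat) : V :=
  if insub i is Some j then f j else v0.

Definition setup_input (R : realType) (T d : nat) : store R :=
  Store
    (fun a i j =>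
       if (a == params) && (i == 0%N) then nth 0%N [:: T; d] j else 0%N)
    (fun _ _ _ => 0).

Definition grid_size (R : realType) (A : algorithm) (T d : nat) : nat :=
  ints (exec (setup A) (setup_input R T d)) size_out 0 0.

(** The input of round [t] reveals the contexts up to round [t] included, but
    the labels and the draws of the earlier rounds only; everything else is
    zero. *)
Definition round_input (R : realType) (T d N : nat)
    (x : 'I_T -> 'rV[R]_d) (y : 'I_T -> bool) (k : 'I_T -> 'I_N.+1) (t : 'I_T) :
    store R :=
  Store
    (fun a i j =>
       if (a == params) && (i == 0%N) then nth 0%N [:: T; d; N; val t] j
       else if [&& a == labels, (i < t)%N & j == 0%N] then
         pad 0%N (fun s => nat_of_bool (y s)) i
       else if [&& a == draws, (i < t)%N & j == 0%N] then
         pad 0%N (fun s => val (k s)) i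
       else 0%N)
    (fun a i j =>
       if (a == contexts) && (i <= t)%N then
         pad 0 (fun s => pad 0 (fun l => x s 0 l) j) i
       else 0).

Definition forecast (R : realType) (A : algorithm) (T d N : nat)
    (x : 'I_T -> 'rV[R]_d) (y : 'I_T -> bool) (k : 'I_T -> 'I_N.+1) (t : 'I_T)
    (j : 'I_N.+1) : R :=
  reals (exec (round A) (round_input x y k t)) weights j 0.

Definition is_distribution (R : realType) (I : finType) (P : I -> R) : Prop :=
  (forall i, 0 <= P i) /\ \sum_i P i = 1.

(** Probability that the successive draws are [k 0], [k 1], ... *)
Definition draws_prob (R : realType) (A : algorithm) (T d N : nat)
    (x : 'I_T -> 'rV[R]_d) (y : 'I_T -> bool) (k : {ffun 'I_T -> 'I_N.+1}) : R :=
  \prod_(t < T) forecast A x y k t (k t).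

Definition prob (R : realType) (I : finType) (P : I -> R) (E : pred I) : R :=
  \sum_(i | E i) P i.

Definition expectation_fin (R : realType) (I : finType) (P : I -> R)
    (Z : I -> \bar R) : \bar R :=
  (\sum_i (P i)%:E * Z i)%E.

(** Running time over the whole play; the summand [N.+1] is the time needed to
    sample from an explicitly given distribution on [N.+1] points. *)
Definition running_time (R : realType) (A : algorithm) (T d N : nat)
    (x : 'I_T -> 'rV[R]_d) (y : 'I_T -> bool) (k : 'I_T -> 'I_N.+1) : nat :=
  (cost (setup A) (setup_input R T d)
   + \sum_(t < T) (cost (round A) (round_input x y k t) + N.+1))%N.

(** * Contexts, linear functions, swap multicalibration *)

Definition dot (R : realType) (d : nat) (u v : 'rV[R]_d) : R :=
  \sum_(i < d) u 0 i * v 0 i.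

(** The norm provided by the library on ['rV[R]_d] is the sup norm. *)
Definition norm2 (R : realType) (d : nat) (u : 'rV[R]_d) : R :=
  Num.sqrt (dot u u).

Definition context_space (R : realType) (d : nat) : set 'rV[R]_d :=
  [set x | norm2 x <= 1 /\ forall i : 'I_d, val i = 0%N -> x 0 i = 1 / 2%:R].

Definition F_lin (R : realType) (d : nat) : set ('rV[R]_d -> R) :=
  [set f | exists theta : 'rV[R]_d, f = fun x => dot theta x].

Definition F1_lin (R : realType) (d : nat) : set ('rV[R]_d -> R) :=
  [set f | F_lin f /\ forall x, context_space x -> f x ^+ 2 <= 1].

Definition grid (R : realType) (N : nat) (j : 'I_N.+1) : R := j%:R / N%:R.

Definition hits (R : realType) (T : nat) (p : 'I_T -> R) (z : R) : nat :=
  (\sum_(t < T) (p t == z))%N.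

(** Division by zero yields [0], which is the convention for [rho] at the points
    that are never predicted. *)
Definition rho (R : realType) (T d : nat) (x : 'I_T -> 'rV[R]_d)
    (y : 'I_T -> bool) (p : 'I_T -> R) (z : R) (f : 'rV[R]_d -> R) : R :=
  (\sum_(t < T | p t == z) f (x t) * ((y t)%:R - z)) / (hits p z)%:R.

(** Extended-real valued, because the supremum may be infinite for an
    arbitrary class [F]. *)
Definition SMCal (R : realType) (T d N : nat) (F : set ('rV[R]_d -> R)) (q : R)
    (x : 'I_T -> 'rV[R]_d) (y : 'I_T -> bool) (p : 'I_T -> R) : \bar R :=
  (\sum_(j < N.+1)
     (hits p (grid R j))%:R%:E *
     ereal_sup [set (`|rho x y p (grid R j) f| `^ q)%R%:E | f in F])%E.

Definition efficient (R : realType) (A : algorithm) : Prop :=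
  exists c e : nat, forall T d : nat, (2 <= T)%N -> (1 <= d)%N ->
    forall (x : 'I_T -> 'rV[R]_d) (y : 'I_T -> bool)
      (k : 'I_T -> 'I_(grid_size R A T d).+1),
    (forall t, context_space (x t)) ->
    (running_time A x y k <= c * (T + d) ^ e)%N.

(* Main.v *)
Require Import Defs.
From HB Require Import structures.
From mathcomp Require Import all_boot all_order all_algebra.
From mathcomp Require Import all_classical all_reals all_analysis.
From mathcomp Require Import ring lra zify.

(** Every [f] in the class has coefficient vector of norm at most 2, so the
    error is at most [4 * \sum_j |S_j|^2 / n_j], where [S_j] is the sum of
    [(y_s - j/N) x_s] over the [n_j] rounds with prediction [j/N].  In round [t]
    let [g_j = <S_j, x_t> / (n_j + 1)].  The forecaster predicts [0] if
    [g_0 <= 0], predicts [1] if all [g_j] are positive, and otherwise mixes two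
    neighbours [m-1], [m] with [g_(m-1) > 0 >= g_m] so that [g] has mean zero;
    then the mean of [g_j (y_t - j/N)] is at most the mean of [|g_j| / (2N)]
    for both labels.  Drawing [j] raises [|S_j|^2 / n_j] by at most
    [2 g_j (y_t - j/N) - g_j^2 + 1 / (n_j + 1)].  The negative square absorbs
    both [|g_j| / N], up to [1 / (2 N^2)], and the second-order term of the
    exponential moment.  Hence the potential is [O (T / N^2 + N log T)] with
    exponential tails of constant scale, and the grid size
    [N ~ (T / (d log T))^(1/3)] gives the rate.  If [d log T] exceeds [T], up to
    a constant, the trivial bound [4 T] on the error suffices. *)

Set Implicit Arguments.
Unset Strict Implicit.
Unset Printing Implicit Defensive.

Import Order.TTheory GRing.Theory Num.Theory.

Local Open Scope ring_scope.

(** * Adaptive draws *)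

Definition ffun_upd (I J : finType) (k : {ffun I -> J}) (i : I) (j : J) :
    {ffun I -> J} := [ffun s => if s == i then j else k s].

(** Fubini for one coordinate: a function is determined by its copy with coordinate [i] reset to
    [j0], together with its value at [i]. *)
Lemma sum_ffun_upd (R : nmodType) (I J : finType) (F : {ffun I -> J} -> R)
    (i : I) (j0 : J) :
  \sum_k F k = \sum_(k : {ffun I -> J} | k i == j0) \sum_j F (ffun_upd k i j).
Proof.
rewrite (partition_big (fun k : {ffun I -> J} => ffun_upd k i j0)
           (fun k : {ffun I -> J} => k i == j0)) /=; last first.
  by move=> k _; rewrite ffunE eqxx.
apply: eq_bigr => k0 /eqP k0i.
rewrite (reindex_onto (ffun_upd k0 i) (fun k : {ffun I -> J} => k i)) /=; last first.
  move=> k /eqP <-; apply/ffunP => s; rewrite !ffunE.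
  by case: eqP => // ->.
apply: eq_bigl => j; rewrite ffunE !eqxx andbT.
apply/eqP/ffunP => s; rewrite !ffunE.
by case: eqP => // ->.
Qed.

Section Kernels.
Variables (R : numDomainType) (T : nat) (J : finType) (j0 : J).
Variable a : 'I_T -> {ffun 'I_T -> J} -> R.
Hypothesis a_past : forall (t : 'I_T) (k k' : {ffun 'I_T -> J}),
  (forall s : 'I_T, (s <= t)%N -> k s = k' s) -> a t k = a t k'.

(* Only the first [m] coordinates are drawn; the others are frozen at [j0]. *)
Let partial (m : nat) (k : {ffun 'I_T -> J}) : R :=
  \prod_(t < T) (if (t < m)%N then a t k else (k t == j0)%:R).

(** Coordinates after [m] are frozen and earlier factors do not see coordinate [m], so the sum over
    that coordinate reaches only the factor of round [m]. *)
Let partial_step (m : 'I_T) :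
  \sum_k partial m.+1 k
  = \sum_(k : {ffun 'I_T -> J} | k m == j0) partial m k * \sum_j a m (ffun_upd k m j).
Proof.
rewrite (sum_ffun_upd _ m j0); apply: eq_bigr => k kmj0.
rewrite mulr_sumr; apply: eq_bigr => j _.
rewrite /partial (bigD1 m) //= ltnSn [RHS]mulrC; congr (_ * _).
rewrite [RHS](bigD1 m) //= ltnn kmj0 mul1r; apply: eq_bigr => t tm.
have tm' : (t == m :> nat) = false by apply/negbTE.
rewrite ltnS leq_eqVlt tm' /=; case: ifP => tltm; last by rewrite ffunE (negbTE tm).
apply: a_past => s st; rewrite ffunE; case: eqP => // sm.
by move: tltm; rewrite -sm ltnNge st.
Qed.

Let sum_partial0 : \sum_k partial 0 k = 1.
Proof.
rewrite (bigD1 [ffun=> j0]) //= big1 ?addr0.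
  by rewrite /partial big1 // => t _; rewrite ffunE eqxx.
move=> k kj0; apply/eqP; rewrite prodf_seq_eq0; apply/hasP.
have [t kt] : exists t, k t != j0.
  apply/existsP; rewrite -negb_forall; apply: contra kj0 => /forallP kj.
  by apply/eqP/ffunP => t; rewrite ffunE; apply/eqP.
by exists t; rewrite ?mem_index_enum //= (negbTE kt).
Qed.

Let partial_mono (m : 'I_T) :
  \sum_k partial m k = \sum_(k : {ffun 'I_T -> J} | k m == j0) partial m k.
Proof.
rewrite [RHS]big_mkcond; apply: eq_bigr => k _; case: ifPn => // kmj0.
by rewrite /partial (bigD1 m) //= ltnn (negbTE kmj0) mul0r.
Qed.

Let sum_partialT : \sum_k \prod_(t < T) a t k = \sum_k partial T k.
Proof. by apply: eq_bigr => k _; apply: eq_bigr => t _; rewrite ltn_ord. Qed.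

(** Tower property: the draws are summed out one at a time, the latest first. *)
Lemma sum_kernels_eq1 :
  (forall t (k : {ffun 'I_T -> J}), \sum_j a t (ffun_upd k t j) = 1) ->
  \sum_k \prod_(t < T) a t k = 1.
Proof.
move=> a1; rewrite sum_partialT.
suff H m : (m <= T)%N -> \sum_k partial m k = 1 by exact: H.
elim: m => [//|m IH mT]; rewrite -(IH (ltnW mT)).
rewrite (partial_step (Ordinal mT)) (partial_mono (Ordinal mT)).
by apply: eq_bigr => k _; rewrite a1 mulr1.
Qed.

(** Supermartingale version, used for exponential moments; nonnegativity lets each inner sum be
    replaced by its bound [1]. *)
Lemma sum_kernels_le1 :
  (forall t k, 0 <= a t k) ->
  (forall t (k : {ffun 'I_T -> J}), \sum_j a t (ffun_upd k t j) <= 1) ->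
  \sum_k \prod_(t < T) a t k <= 1.
Proof.
move=> a0 a1; rewrite sum_partialT.
suff H m : (m <= T)%N -> \sum_k partial m k <= 1 by exact: H.
elim: m => [_|m IH mT]; first by rewrite sum_partial0.
apply: le_trans (IH (ltnW mT)).
rewrite (partial_step (Ordinal mT)) (partial_mono (Ordinal mT)).
apply: ler_sum => k _; rewrite ler_piMr // prodr_ge0 // => t _.
by case: ifP.
Qed.

End Kernels.

(** * The potential *)

Section Dot.
Variables (R : realType) (d : nat).
Implicit Types u v w : 'rV[R]_d.

Lemma dotC u v : dot u v = dot v u.
Proof. by apply: eq_bigr => i _; rewrite mulrC. Qed.

Lemma dotDl u v w : dot (u + v) w = dot u w + dot v w.
Proof. by rewrite -big_split /=; apply: eq_bigr => i _; rewrite mxE mulrDl. Qed.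

Lemma dotZl (a : R) u v : dot (a *: u) v = a * dot u v.
Proof. by rewrite mulr_sumr; apply: eq_bigr => i _; rewrite mxE mulrA. Qed.

Lemma dot0l u : dot 0 u = 0.
Proof. by rewrite /dot big1 // => i _; rewrite mxE mul0r. Qed.

Lemma dotDr u v w : dot u (v + w) = dot u v + dot u w.
Proof. by rewrite dotC dotDl !(dotC u). Qed.

Lemma dotZr (a : R) u v : dot u (a *: v) = a * dot u v.
Proof. by rewrite dotC dotZl dotC. Qed.

Lemma dot_suml (I : Type) (r : seq I) (P : pred I) (F : I -> 'rV[R]_d) v :
  dot (\sum_(i <- r | P i) F i) v = \sum_(i <- r | P i) dot (F i) v.
Proof. exact: (big_morph (fun u => dot u v) (fun u w => dotDl u w v) (dot0l v)). Qed.

Lemma dot_ge0 u : 0 <= dot u u.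
Proof. by apply: sumr_ge0 => i _; rewrite -expr2 sqr_ge0. Qed.

Lemma dot_eq0 u : dot u u = 0 -> u = 0.
Proof.
move=> /eqP; rewrite psumr_eq0 => [/allP u0|i _]; last by rewrite -expr2 sqr_ge0.
apply/rowP => i; rewrite mxE; apply/eqP.
by have := u0 i (mem_index_enum i); rewrite /= -expr2 sqrf_eq0.
Qed.

Lemma Cauchy_Schwarz u v : dot u v ^+ 2 <= dot u u * dot v v.
Proof.
have [/dot_eq0 -> | u0] := eqVneq (dot u u) 0.
  by rewrite !dot0l expr0n mul0r.
have {}u0 : 0 < dot u u by rewrite lt0r u0 dot_ge0.
(* The square of this vector is [dot u u] times the difference of the two sides. *)
have := dot_ge0 (dot u u *: v + (- dot u v) *: u).
rewrite !(dotDl, dotDr, dotZl, dotZr) (dotC v u) => H.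
rewrite -subr_ge0 -(pmulr_rge0 _ u0); apply: le_trans H _.
by rewrite le_eqVlt; apply/orP; left; apply/eqP; ring.
Qed.

Lemma norm_dot_le1 u v : dot u u <= 1 -> dot v v <= 1 -> `|dot u v| <= 1.
Proof.
move=> u1 v1; rewrite -(@ler_pXn2r _ 2) ?nnegrE // expr1n real_normK ?num_real //.
apply: le_trans (Cauchy_Schwarz u v) _.
by apply: mulr_ile1 => //; exact: dot_ge0.
Qed.

End Dot.

Definition harmonic_sum (R : realType) (n : nat) : R := \sum_(i < n) (i.+1%:R)^-1.

(** * Growth of the potential along a play *)

Section Potential.
Variables (R : realType) (T d N : nat).
Variables (x : 'I_T -> 'rV[R]_d) (y : 'I_T -> bool) (k : 'I_T -> 'I_N.+1).

Definition count_to (m : nat) (j : 'I_N.+1) : nat :=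
  \sum_(s < T | (s < m)%N && (k s == j)) 1.

Definition residual (m : nat) (j : 'I_N.+1) : 'rV[R]_d :=
  \sum_(s < T | (s < m)%N && (k s == j)) ((y s)%:R - grid R j) *: x s.

Definition correlation (t : 'I_T) (j : 'I_N.+1) : R :=
  dot (residual t j) (x t) / (count_to t j).+1%:R.

Definition gain (t : 'I_T) (j : 'I_N.+1) : R :=
  2 * correlation t j * ((y t)%:R - grid R j) - correlation t j ^+ 2.

Definition potential (j : 'I_N.+1) : R :=
  dot (residual T j) (residual T j) / (count_to T j)%:R.

Hypothesis x1 : forall t, dot (x t) (x t) <= 1.
Hypothesis N0 : (0 < N)%N.

Lemma grid_itv (j : 'I_N.+1) : 0 <= grid R j <= 1.
Proof.
rewrite /grid divr_ge0 //= ler_pdivrMr ?ltr0n // mul1r ler_nat.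
by rewrite -ltnS.
Qed.

Lemma label_sub_grid (b : bool) (j : 'I_N.+1) : `|b%:R - grid R j| <= 1.
Proof.
have /andP[? ?] := grid_itv j.
by rewrite ler_norml; case: b => /=; rewrite ?sub0r ?mulr1n; apply/andP; split; lra.
Qed.

(** Splits off the last round when the prefix is encoded as a filter [s < m] on ['I_T]. *)
Lemma big_ordS_cond (V : nmodType) (P : pred 'I_T) (F : 'I_T -> V) (t : 'I_T) :
  \sum_(s < T | (s < t.+1)%N && P s) F s
  = \sum_(s < T | (s < t)%N && P s) F s + (if P t then F t else 0).
Proof.
case: ifPn => Pt; last first.
  rewrite addr0; apply: eq_bigl => s; rewrite ltnS leq_eqVlt.
  by have [/val_inj ->|//] := eqVneq (val s) t; rewrite (negbTE Pt) !andbF.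
rewrite (bigD1 t) /= ?ltnSn // addrC; congr (_ + _); apply: eq_bigl => s.
by rewrite ltnS [in RHS]ltn_neqAle -(inj_eq val_inj) andbC andbA.
Qed.

Lemma count_toS (t : 'I_T) j : count_to t.+1 j = (count_to t j + (k t == j))%N.
Proof.
rewrite /count_to (big_ordS_cond (fun s => k s == j) (fun=> 1%N)).
by case: (k t == j).
Qed.

Lemma residualS (t : 'I_T) j :
  residual t.+1 j
  = residual t j + (if k t == j then ((y t)%:R - grid R j) *: x t else 0).
Proof. exact: (big_ordS_cond (fun s => k s == j)). Qed.

Lemma norm_dot_residual (m : nat) j u :
  dot u u <= 1 -> `|dot (residual m j) u| <= (count_to m j)%:R.
Proof.
move=> u1; rewrite dot_suml (le_trans (ler_norm_sum _ _ _)) //.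
rewrite natr_sum ler_sum // => s _; rewrite dotZl normrM.
by rewrite mulr_ile1 ?label_sub_grid ?norm_dot_le1.
Qed.

Lemma dot_residual_le (m : nat) j :
  dot (residual m j) (residual m j) <= (count_to m j)%:R ^+ 2.
Proof.
rewrite {1}/residual dot_suml.
apply: (@le_trans _ _ (\sum_(s < T | (s < m)%N && (k s == j)) (count_to m j)%:R)).
  apply: ler_sum => s _; rewrite dotZl (le_trans (ler_norm _)) // normrM.
  rewrite -[leRHS]mul1r ler_pM ?label_sub_grid // dotC.
  exact: norm_dot_residual.
by rewrite sumr_const -sum1_card expr2 mulr_natr.
Qed.

Lemma norm_correlation_le1 t j : `|correlation t j| <= 1.
Proof.
rewrite normrM normfV normr_nat ler_pdivrMr ?ltr0n // mul1r.
by rewrite (le_trans (norm_dot_residual _ _ (x1 t))) // ler_nat.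
Qed.

(** One draw of [j], with [n] earlier visits: [a] is the squared length of the residual, [b] its
    product with the context, [c] the label minus the prediction, [q] the squared length of the
    context. *)
Lemma potential_step (n : nat) (a b c q : R) :
  (n = 0%N -> a = 0) -> 0 <= a -> b ^+ 2 <= a -> q <= 1 -> `|c| <= 1 ->
  (a + 2 * c * b + c ^+ 2 * q) / n.+1%:R
  <= a / n%:R + (2 * (b / n.+1%:R) * c - (b / n.+1%:R) ^+ 2) + n.+1%:R^-1.
Proof.
move=> n0 a0 ba q1 c1.
have c2 : c ^+ 2 <= 1 by rewrite -(real_normK (num_real c)) expr_le1.
have c2q : c ^+ 2 * q <= 1.
  by rewrite (le_trans (ler_wpM2l (sqr_ge0 c) q1)) // mulr1.
(* At the first visit [a / 0] is [0]; this is harmless since then [a = 0], hence [b = 0]. *)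
case: n n0 => [n0|n _].
  by have a00 := n0 erefl; rewrite !divr1 invr1 a00 mul0r; rewrite a00 in ba; nra.
have := ltr0n R n.+1; set u : R := n.+1%:R => /= u0.
rewrite -[n.+2%:R]natr1 -/u.
have u1 : 0 < u + 1 by rewrite addr_gt0.
rewrite -subr_ge0.
(* Over the common denominator every summand of the numerator is nonnegative. *)
have -> : a / u + (2 * (b / (u + 1)) * c - (b / (u + 1)) ^+ 2) + (u + 1)^-1 -
   (a + 2 * c * b + c ^+ 2 * q) / (u + 1)
  = ((a - b ^+ 2) * u + a + (1 - c ^+ 2 * q) * u * (u + 1)) / (u * (u + 1) ^+ 2).
  by field; rewrite !gt_eqF.
rewrite divr_ge0 ?addr_ge0 ?mulr_ge0 ?subr_ge0 ?exprn_ge0 //; exact: ltW.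
Qed.

(** Only rounds that predict [j] change its potential, and their terms [1 / (n + 1)] add up to a
    harmonic number. *)
Lemma potential_le j :
  potential j <= harmonic_sum R (count_to T j) + \sum_(t < T | k t == j) gain t j.
Proof.
suff H m : (m <= T)%N ->
    dot (residual m j) (residual m j) / (count_to m j)%:R
    <= harmonic_sum R (count_to m j)
       + \sum_(t < T | (t < m)%N && (k t == j)) gain t j.
  by have := H T (leqnn T); under [X in _ <= _ + X]eq_bigl do rewrite ltn_ord.
elim: m => [_|m IH mT].
  rewrite /residual /count_to !big_pred0 // dot0l mul0r addr0.
  by rewrite /harmonic_sum big_ord0.
have {IH} := IH (ltnW mT); pose t := Ordinal mT; rewrite -[m]/(val t).
rewrite (big_ordS_cond (fun s => k s == j) (fun s => gain s j)).
rewrite count_toS residualS.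
case: (k t == j); last by rewrite addn0 !addr0.
move=> IH; rewrite addn1 /harmonic_sum big_ord_recr /= -/(harmonic_sum R _).
have n0 : count_to t j = 0%N -> dot (residual t j) (residual t j) = 0.
  move=> n0; apply/eqP; rewrite eq_le dot_ge0 andbT.
  by rewrite (le_trans (dot_residual_le t j)) // n0 expr0n.
have ba : dot (residual t j) (x t) ^+ 2 <= dot (residual t j) (residual t j).
  rewrite (le_trans (Cauchy_Schwarz _ _)) // -[leRHS]mulr1.
  by rewrite ler_wpM2l ?dot_ge0.
have := potential_step n0 (dot_ge0 _) ba (x1 t) (label_sub_grid (y t) j).
rewrite -/(correlation t j) -/(gain t j) => H.
rewrite !(dotDl, dotDr, dotZl, dotZr) (dotC (x t)).
apply: le_trans (_ : _ <= _ + gain t j + (count_to t j).+1%:R^-1) _; last first.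
  by rewrite -addrA (addrC (gain _ _)) addrACA lerD2r; exact: IH.
by apply: le_trans H; rewrite le_eqVlt; apply/orP; left; apply/eqP; congr (_ / _); ring.
Qed.

Lemma harmonic_sum_le (m n : nat) : (m <= n)%N -> harmonic_sum R m <= harmonic_sum R n.
Proof.
move=> mn; rewrite /harmonic_sum -(subnKC mn) big_split_ord /= lerDl.
by apply: sumr_ge0 => i _; rewrite invr_ge0.
Qed.

Lemma count_to_le m j : (count_to m j <= T)%N.
Proof. by rewrite /count_to sum1_card -[X in (_ <= X)%N]card_ord max_card. Qed.

Lemma sum_count_to : (\sum_j count_to T j = T)%N.
Proof.
rewrite /count_to -[RHS]card_ord -sum1_card (partition_big k predT) //=.
by apply: eq_bigr => j _; apply: eq_bigl => t; rewrite ltn_ord.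
Qed.

Lemma sum_potential_le :
  \sum_j potential j <= N.+1%:R * harmonic_sum R T + \sum_t gain t (k t).
Proof.
apply: le_trans (ler_sum _ (fun j _ => potential_le j)) _.
rewrite big_split /= lerD //.
  rewrite -[in leRHS](card_ord N.+1) mulr_natl -sumr_const ler_sum // => j _.
  by rewrite harmonic_sum_le ?count_to_le.
rewrite [leRHS](partition_big k predT) //= ler_sum // => j _.
by rewrite le_eqVlt; apply/orP; left; apply/eqP/eq_bigr => t /eqP ->.
Qed.

(** Each residual is a sum of [count_to T j] vectors of norm at most 1. This serves the regime where
    the rate exceeds the horizon up to a constant. *)
Lemma sum_potential_leT : \sum_j potential j <= T%:R.
Proof.
rewrite -[in leRHS]sum_count_to natr_sum ler_sum // => j _.
have [n0|n0] := eqVneq (count_to T j) 0%N.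
  by rewrite /potential n0 invr0 mulr0.
rewrite ler_pdivrMr ?ltr0n ?lt0n // -expr2.
exact: dot_residual_le.
Qed.

End Potential.

(** * Balanced mixtures *)

(** Inverting [expR (- u) >= 1 - u] gives [expR u <= 1 / (1 - u)], and the quadratic times [1 - u]
    is [1 + u ^ 2 (1 - 2 u)]. *)
Lemma expR_le_quadratic (R : realType) (u : R) :
  u <= 1 / 2 -> expR u <= 1 + u + 2 * u ^+ 2.
Proof.
move=> u2; have u1 : 0 < 1 - u by lra.
have := expR_ge1Dx (- u); rewrite expRN => H.
have H2 : expR u <= (1 - u)^-1.
  by rewrite -[leLHS]invrK lef_pV2 // posrE invr_gt0 expR_gt0.
apply: le_trans H2 _; rewrite -[leLHS]mul1r ler_pdivrMr //.
have -> : (1 + u + 2 * u ^+ 2) * (1 - u) = 1 + u ^+ 2 * (1 - 2 * u) by ring.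
by rewrite lerDl mulr_ge0 ?sqr_ge0 //; lra.
Qed.

Section Mixture.
Variables (R : realType) (N : nat).
Hypothesis N0 : (0 < N)%N.

(** The factor is half the grid step: two neighbours mixed so that [g] has mean zero attain
    equality. *)
Definition balanced (b : R) (w g : 'I_N.+1 -> R) : Prop :=
  \sum_j w j * (g j * (b - grid R j))
  <= (2 * N%:R)^-1 * \sum_j w j * `|g j|.

(* [36] is chosen so that the quadratic term of the exponential takes only half
   of [g j ^+ 2]; the other half pays for [`|g j| / N] by AM-GM. *)
Lemma expR_gain_le1 (b : bool) (w g : 'I_N.+1 -> R) :
  is_distribution w -> (forall j, `|g j| <= 1) -> balanced b%:R w g ->
  \sum_j w j * expR (36^-1 * (2 * g j * (b%:R - grid R j) - g j ^+ 2
                              - (2 * N%:R ^+ 2)^-1)) <= 1.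
Proof.
move=> [w0 w1] g1 bal; set q : R := (2 * N%:R ^+ 2)^-1.
have n0 : 0 < N%:R :> R by rewrite ltr0n.
set v : R := N%:R^-1.
have qE : q = v ^+ 2 / 2 by rewrite /q /v; field; rewrite gt_eqF.
have step j : expR (36^-1 * (2 * g j * (b%:R - grid R j) - g j ^+ 2))
    <= 1 + 36^-1 * (2 * (g j * (b%:R - grid R j)) - g j ^+ 2 / 2).
  set c := b%:R - _; have c1 : `|c| <= 1 by exact: label_sub_grid.
  move: (g1 j) c1; rewrite !ler_norml => /andP[g1l g1r] /andP[c1l c1r].
  have gc : (g j * c) ^+ 2 <= g j ^+ 2.
    by rewrite exprMn ler_piMr ?sqr_ge0 // -[leRHS](expr1n _ 2); nra.
  have g2 : g j ^+ 4 <= g j ^+ 2.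
    rewrite (_ : g j ^+ 4 = g j ^+ 2 * g j ^+ 2); last by rewrite -exprD.
    by rewrite ler_piMr ?sqr_ge0 //; nra.
  have /andP[gc1 gc2] : -1 <= g j * c <= 1 by apply/andP; split; nra.
  have g2' : g j ^+ 4 = (g j ^+ 2) ^+ 2 by rewrite -exprM.
  rewrite g2' in g2; rewrite -mulrA.
  set e := g j * c in gc gc1 gc2 *.
  set a := g j ^+ 2 in gc g2 *.
  have a0 : 0 <= a by rewrite sqr_ge0.
  apply: le_trans (expR_le_quadratic _) _.
    by lra.
  have ea : - (e * a) <= a by rewrite -mulNr ler_piMl //; lra.
  (* Here [(2 e - a) ^ 2 = 4 e ^ 2 - 4 e a + a ^ 2 <= 9 a], and twice this over [36 ^ 2] is
     [a / 72], half of [a / 36]. *)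
  nra.
have -> : \sum_j w j * expR (36^-1 * (2 * g j * (b%:R - grid R j) - g j ^+ 2 - q))
   = (\sum_j w j * expR (36^-1 * (2 * g j * (b%:R - grid R j) - g j ^+ 2)))
     * expR (- (36^-1 * q)).
  by rewrite mulr_suml; apply: eq_bigr => j _; rewrite mulrBr expRD mulrA.
rewrite expRN ler_pdivrMr ?expR_gt0 // mul1r.
(* The allowance [q / 36] is kept only to first order, so a bound on the mean of the linearized
   terms suffices. *)
apply: le_trans (expR_ge1Dx _).
apply: le_trans (ler_sum _ (fun j _ => ler_wpM2l (w0 j) (step j))) _.
have -> : \sum_j w j * (1 + 36^-1 * (2 * (g j * (b%:R - grid R j)) - g j ^+ 2 / 2))
   = 1 + 36^-1 * (2 * (\sum_j w j * (g j * (b%:R - grid R j)))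
        - (\sum_j w j * g j ^+ 2) / 2).
  rewrite -[X in _ = X + _]w1 mulr_sumr mulr_suml -sumrB mulr_sumr -big_split /=.
  by apply: eq_bigr => j _; ring.
rewrite lerD2l ler_pM2l ?invr_gt0 //.
suff : v * (\sum_j w j * `|g j|) <= q + (\sum_j w j * g j ^+ 2) / 2.
  have : 2 * (\sum_j w j * (g j * (b%:R - grid R j))) <= v * (\sum_j w j * `|g j|).
    rewrite (le_trans (ler_wpM2l _ bal)) // mulrA invfM -/v mulrA divff ?mul1r //.
  lra.
rewrite -[q]mulr1 -[X in q * X]w1 !mulr_sumr mulr_suml -big_split /= ler_sum // => j _.
have -> : q * w j + w j * g j ^+ 2 / 2 = w j * (q + g j ^+ 2 / 2) by ring.
rewrite mulrCA ler_wpM2l // qE.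
have := sqr_ge0 (v - `|g j|); rewrite sqrrB real_normK ?num_real //.
lra.
Qed.

(* At [m = 0] the two indices coincide, and only [alpha] counts. *)
Definition mixture (alpha : R) (m j : nat) : R :=
  if j == m then alpha else if j == m.-1 then 1 - alpha else 0.

(** The weight of [m] that gives [g] mean zero over [m.-1] and [m]. The value [1] covers a point
    mass at [m = 0], or at the last grid point when [g] is still positive there. *)
Definition mixing_weight (g : nat -> R) (m : nat) : R :=
  if (0 < m)%N && (g m <= 0) then g m.-1 / (g m.-1 - g m) else 1.

Lemma sum_mixture alpha m (F : nat -> R) : (m <= N)%N -> (m = 0%N -> alpha = 1) ->
  \sum_(j < N.+1) mixture alpha m j * F j = alpha * F m + (1 - alpha) * F m.-1.
Proof.
move=> mN m0; have mN1 : (m < N.+1)%N by [].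
rewrite (bigD1 (Ordinal mN1)) //= {1}/mixture eqxx; congr (_ + _).
case: m => [|m] in m0 mN mN1 *.
  rewrite m0 // subrr mul0r big1 // => j j0.
  rewrite /mixture /= ifF ?ifF ?mul0r //; exact/negbTE.
have mN' : (m < N.+1)%N by exact: ltnW.
rewrite (bigD1 (Ordinal mN')) /=; last by rewrite -val_eqE /= ltn_eqF.
rewrite /mixture /= ltn_eqF // eqxx big1 ?addr0 // => j /andP[j1 j2].
by rewrite !ifF ?mul0r //; apply/negbTE.
Qed.

Section FirstNonpositive.
Variables (g : nat -> R) (m : nat).
Hypothesis mN : (m <= N)%N.
Hypothesis gpos : forall j, (j < m)%N -> 0 < g j.
Hypothesis gm : m = N \/ g m <= 0.

Let w (j : 'I_N.+1) : R := mixture (mixing_weight g m) m j.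

Let weight0 : m = 0%N -> mixing_weight g m = 1.
Proof. by rewrite /mixing_weight => ->. Qed.

Lemma mixing_weight_itv : 0 <= mixing_weight g m <= 1.
Proof.
rewrite /mixing_weight; case: ifPn => [/andP[m0 g0]|_]; last by rewrite ler01 lexx.
have g1 : 0 < g m.-1 by rewrite gpos // prednK.
have g2 : 0 < g m.-1 - g m by lra.
apply/andP; split; first by rewrite divr_ge0 // ltW.
by rewrite ler_pdivrMr // mul1r; lra.
Qed.

Lemma mixture_distribution : is_distribution w.
Proof.
have /andP[a0 a1] := mixing_weight_itv.
split=> [j|].
  by rewrite /w /mixture; case: ifP => // _; case: ifP => // _; rewrite subr_ge0.
under eq_bigr do rewrite -[w _]mulr1.
by rewrite (sum_mixture (fun=> 1)) // !mulr1 addrC subrK.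
Qed.

(** A genuine mixture gives equality. A point mass at prediction 0 has [g <= 0] and nonnegative
    label gap; one at prediction 1 has [g >= 0] and nonpositive gap. *)
Lemma mixture_balanced (b : bool) : balanced b%:R w (fun j => g j).
Proof.
have n0 : 0 < N%:R :> R by rewrite ltr0n.
rewrite /balanced.
rewrite (sum_mixture (fun j => g j * (b%:R - j%:R / N%:R))) //.
rewrite (sum_mixture (fun j => `|g j|)) // /mixing_weight.
have rhs0 (u : R) : 0 <= (2 * N%:R)^-1 * (1 * `|u| + (1 - 1) * `|g m.-1|).
  by rewrite subrr mul0r addr0 mul1r mulr_ge0 // invr_ge0 mulr_ge0 // ltW.
case: ifPn => [/andP[m0 g0]|].
  have g1 : 0 < g m.-1 by rewrite gpos // prednK.
  rewrite (gtr0_norm g1) (ler0_norm g0).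
  have -> : m%:R = m.-1%:R + 1 :> R by rewrite natr1 prednK.
  rewrite le_eqVlt; apply/orP; left; apply/eqP.
  (* Both sides equal [g m.-1 * (- g m) / (N * (g m.-1 - g m))]. *)
  by field; rewrite !gt_eqF //; lra.
rewrite negb_and -leqNgt leqn0 => /orP[/eqP m0|/negbTE gm'].
  apply: le_trans (rhs0 _); rewrite subrr mul0r addr0 mul1r.
  move: gm; rewrite m0 => -[mE|g0]; first by move: N0; rewrite -mE.
  by rewrite mul0r subr0; case: b; rewrite ?mulr1 ?mulr0.
case: gm => [mE|]; last by rewrite gm'.
apply: le_trans (rhs0 _); rewrite subrr mul0r addr0 mul1r.
have g0 : 0 <= g m by rewrite ltW // ltNge gm'.
by rewrite mE divff ?gt_eqF // -mE mulr_ge0_le0 // subr_le0; case: b.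
Qed.

End FirstNonpositive.
End Mixture.

(** * Running time *)

Fixpoint writes_ints (a : nat) (c : cmd) : bool :=
  match c with
  | Skip | SetR _ _ _ _ => false
  | SetI b _ _ _ => b == a
  | Seq c1 c2 | If _ c1 c2 => writes_ints a c1 || writes_ints a c2
  | For b _ c1 => (b == a) || writes_ints a c1
  end.

Definition is_param (e : iexpr) : bool :=
  if e is IGet a (ICst 0) (ICst _) then a == params else false.

Fixpoint param_loops (c : cmd) : bool :=
  match c with
  | Skip | SetI _ _ _ _ | SetR _ _ _ _ => true
  | Seq c1 c2 | If _ c1 c2 => param_loops c1 && param_loops c2
  | For _ e c1 => is_param e && param_loops c1
  end.

(** A syntactic bound: each loop is charged [M] iterations and each conditional both branches,
    giving a polynomial in [M]. *)
Fixpoint cost_bound (M : nat) (c : cmd) : nat :=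
  match c with
  | Skip => 1
  | SetI _ i j e => (isize i + isize j + isize e).+1
  | SetR _ i j e => (isize i + isize j + rsize e).+1
  | Seq c1 c2 => (cost_bound M c1 + cost_bound M c2).+1
  | If b c1 c2 => (test_size b + (cost_bound M c1 + cost_bound M c2)).+1
  | For _ e c1 => (isize e + M * (cost_bound M c1).+1).+1
  end.

Lemma iteri_ind (S : Type) (P : nat -> S -> Prop) (n : nat) (f : nat -> S -> S) m :
  P 0%N m -> (forall i m', (i < n)%N -> P i m' -> P i.+1 (f i m')) ->
  P n (iteri n f m).
Proof.
move=> P0 PS; suff H i : (i <= n)%N -> P i (iteri i f m) by exact: H.
by elim: i => [//|i IH ltin]; apply: PS => //; exact/IH/ltnW.
Qed.

Section Machine.
Variable R : realType.
Implicit Types (m : store R) (c : cmd).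

Lemma exec_ints a c m : ~~ writes_ints a c -> ints (exec c m) a = ints m a.
Proof.
have updE (h : nat -> nat -> nat -> nat) b i j v : b != a -> upd h b i j v a = h a.
  by move=> ba; rewrite /upd eq_sym (negbTE ba).
elim: c m => [|b i j e|b i j e|c1 IH1 c2 IH2|b c1 IH1 c2 IH2|b e c1 IH] m //=.
- exact: updE.
- by rewrite negb_or => /andP[H1 H2]; rewrite IH2 // IH1.
- by rewrite negb_or => /andP[H1 H2]; case: ifP => _; [rewrite IH1|rewrite IH2].
- rewrite negb_or => /andP[ba H].
  apply: (iteri_ind (P := fun _ m' => ints m' a = ints m a)) => // i m' _ <-.
  by rewrite IH //= updE.
Qed.

Lemma exec_Seq c1 c2 m : exec (Seq c1 c2) m = exec c2 (exec c1 m).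
Proof. by []. Qed.

Lemma exec_For (P : nat -> store R -> Prop) a e c m n : ieval m e = n ->
  P 0%N m ->
  (forall i m', (i < n)%N -> P i m' -> P i.+1 (exec c (set_int m' a 0 0 i))) ->
  P n (exec (For a e c) m).
Proof. by move=> <- P0 PS; exact: iteri_ind. Qed.

(** Loop lengths are read from row 0 of [params], which the program never writes, so [M] still
    bounds them at every later state. *)
Lemma cost_le M c m : param_loops c -> ~~ writes_ints params c ->
  (forall j, (ints m params 0 j <= M)%N) -> (cost c m <= cost_bound M c)%N.
Proof.
elim: c m => [|b i j e|b i j e|c1 IH1 c2 IH2|b c1 IH1 c2 IH2|b e c1 IH] m //=.
- move=> /andP[l1 l2]; rewrite negb_or => /andP[w1 w2] mM.
  by rewrite ltnS leq_add ?IH1 ?IH2 // exec_ints.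
- move=> /andP[l1 l2]; rewrite negb_or => /andP[w1 w2] mM.
  rewrite ltnS leq_add2l; case: ifP => _.
    by rewrite (leq_trans (IH1 _ _ _ _)) // leq_addr.
  by rewrite (leq_trans (IH2 _ _ _ _)) // leq_addl.
- move=> /andP[pe l1] w mM; have := w; rewrite negb_or => /andP[bp w1].
  rewrite ltnS leq_add2l.
  have em : (ieval m e <= M)%N.
    by case: e pe => //= a [[|//]|//|//|//] [i|//|//|//] /eqP ->.
  apply: (@leq_trans (\sum_(n < ieval m e) (cost_bound M c1).+1)); last first.
    by rewrite sum_nat_const card_ord leq_mul2r em orbT.
  apply: leq_sum => n _; rewrite ltnS IH // => j /=.
  rewrite /upd eq_sym (negbTE bp) /=.
  (* The earlier iterations of the loop have left [params] unchanged. *)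
  elim: (nat_of_ord n) => [|i IHi] /=; first exact: mM.
  by rewrite exec_ints //= /upd eq_sym (negbTE bp).
Qed.

End Machine.

(** * The programs *)

(** Integer arrays: [visits] holds the counts and [pivot] the index [m] of the mixture. Real arrays,
    numbered separately: [moments] holds the products of the residuals with the current context;
    [share] holds the harmonic number during setup and the weight of the pivot during a round. *)
Local Notation counter := 4%N.
Local Notation coordinate := 5%N.
Local Notation visits := 6%N.
Local Notation pivot := 7%N.
Local Notation moments := 2%N.
Local Notation share := 3%N.
Local Notation param j := (IGet params (ICst 0) (ICst j)).
Local Notation icell a i := (IGet a i (ICst 0)).
Local Notation rcell a i := (RGet a i (ICst 0)).
Local Notation ivar a := (icell a (ICst 0)).
Local Notation rvar a := (rcell a (ICst 0)).
Local Notation iset a i e := (SetI a i (ICst 0) e).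
Local Notation rset a i e := (SetR a i (ICst 0) e).
Local Notation isucc e := (IAdd e (ICst 1)).
Local Notation ipred e := (ISub e (ICst 1)).

(* The grid size is the largest [N <= T] with [N ^ 3 * d * H_T <= T], where
   [H_T] is the [T]-th harmonic number, and [1] if there is none. *)
Definition harmonic_program : cmd :=
  For counter (param 0)
    (rset share (ICst 0)
       (RAdd (rvar share) (RDiv (RNat (ICst 1)) (RNat (isucc (ivar counter)))))).

Definition setup_program : cmd :=
  Seq harmonic_program
  (Seq (iset size_out (ICst 0) (ICst 1))
       (For counter (param 0)
          (If (RLt (RNat (param 0))
                 (RMul (RMul (RNat (isucc (ivar counter)))
                          (RMul (RNat (isucc (ivar counter)))
                             (RNat (isucc (ivar counter)))))
                    (RMul (RNat (param 1)) (rvar share))))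
             Skip
             (iset size_out (ICst 0) (isucc (ivar counter)))))).

(** The test is monotone in the candidate, so the last candidate accepted is the largest one. *)
Lemma setup_programP (R : realType) (T d : nat) :
  let N := ints (exec setup_program (setup_input R T d)) size_out 0 0 in
  let K : R := d%:R * harmonic_sum R T in
  (0 < T)%N -> 1 <= K ->
  [/\ (0 < N <= T)%N, N = 1%N \/ N%:R ^+ 3 * K <= T%:R & T%:R < N.+1%:R ^+ 3 * K].
Proof.
move=> N K T0 K1; rewrite {}/N /setup_program !exec_Seq.
set m1 := exec harmonic_program _.
have [p1 h1] : ints m1 params = ints (setup_input R T d) params
    /\ reals m1 share 0 0 = harmonic_sum R T.
  apply: (@exec_For R (fun n m => ints m params = ints (setup_input R T d) params
    /\ reals m share 0 0 = harmonic_sum R n)) => // [|n m nT [pm hm]].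
    by rewrite /harmonic_sum big_ord0.
  split; first exact: pm.
  by rewrite /= /upd /= hm /harmonic_sum big_ord_recr /= addn1 div1r.
set m2 := exec (iset size_out _ _) _.
(* The bound is [maxn 1 n] because the size starts at 1 before any candidate is tried. *)
pose P n m := [/\ ints m params = ints (setup_input R T d) params,
  reals m share 0 0 = harmonic_sum R T,
  (0 < ints m size_out 0 0)%N /\ (ints m size_out 0 0 <= maxn 1 n)%N,
  ints m size_out 0 0 = 1%N \/ (ints m size_out 0 0)%:R ^+ 3 * K <= T%:R &
  (ints m size_out 0 0 < n)%N -> T%:R < (ints m size_out 0 0).+1%:R ^+ 3 * K].
have K0 : 0 < K by exact: lt_le_trans K1.
have mono (a b : nat) : (a <= b)%N -> a%:R ^+ 3 * K <= b%:R ^+ 3 * K.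
  by move=> ab; rewrite ler_pM2r // lerXn2r ?nnegrE // ler_nat.
set m3 := exec _ m2; suff : P T m3.
  move=> [_ _ [N0 NT] N1 NS]; split; [|exact: N1|].
    by rewrite N0 (leq_trans NT) // geq_max T0 leqnn.
  move: NT NS; set N := ints _ _ _ _ => NT NS.
  have [/NS //|TN] := ltnP N T.
  (* If every candidate up to [T] was accepted, then [T < N + 1 <= (N + 1) ^ 3], and [K >= 1]. *)
  apply: (@lt_le_trans _ _ (N.+1%:R ^+ 3)); last first.
    by rewrite ler_peMr ?exprn_ge0.
  by rewrite -natrX ltr_nat (@leq_trans N.+1) // -[X in (X <= _)%N]expn1 leq_exp2l.
apply: exec_For => [||n m nT [pm hm [N0 Nn] N1 NS]].
- by rewrite /= /upd /= p1.
- by split=> //; left.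
move: N0 Nn N1 NS; rewrite /P /= /upd /= hm pm /= addn1.
set N := ints m _ _ _ => N0 Nn N1 NS.
have -> : n.+1%:R * (n.+1%:R * n.+1%:R) * (d%:R * harmonic_sum R T)
    = n.+1%:R ^+ 3 * K by rewrite /K; ring.
case: ltP => [Tn|nT'] /=; rewrite /upd /=.
  split=> //; first by rewrite N0 (leq_trans Nn) // !leq_max !geq_max leqnn /= leqnSn orbT.
  rewrite -/N => Nn'; have [/NS //|nN] := ltnP N n.
  by apply: lt_le_trans Tn _; exact: mono.
split=> //; [by rewrite leq_max leqnn orbT|by right|by rewrite ltnn].
Qed.

Lemma setup_program_cost (R : realType) (T d : nat) : (0 < T)%N ->
  (cost setup_program (setup_input R T d) <= 100 * (T + d))%N.
Proof.
move=> T0; apply: leq_trans (cost_le (M := T + d) _ _ _) _ => //.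
  by move=> [|[|j]] //=; rewrite ?leq_addr ?leq_addl // nth_nil.
by rewrite /=; lia.
Qed.

Local Notation draw := (icell draws (ivar counter)).
Local Notation mean e := (RDiv (rcell moments e) (RNat (isucc (icell visits e)))).

(** The products with the current context are accumulated directly from the history; the residual
    vectors are never stored. *)
Definition tally_program : cmd :=
  For counter (param 3)
    (Seq (iset visits draw (isucc (icell visits draw)))
         (For coordinate (param 1)
            (rset moments draw
               (RAdd (rcell moments draw)
                  (RMul (RMul (RGet contexts (ivar counter) (ivar coordinate))
                              (RGet contexts (param 3) (ivar coordinate)))
                     (RSub (RNat (icell labels (ivar counter)))
                           (RDiv (RNat draw) (RNat (param 2))))))))).

(** Once the pivot reaches a nonpositive mean, the test fails in all remaining iterations, so no
    early exit is needed. *)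
Definition search_program : cmd :=
  For counter (param 2)
    (If (RLt (RNat (ICst 0)) (mean (ivar pivot)))
        (iset pivot (ICst 0) (isucc (ivar pivot))) Skip).

(** The order of the last two writes matters: at pivot 0 the truncated predecessor is also 0, and
    the second write overrides the first. *)
Definition output_program : cmd :=
  Seq (rset share (ICst 0) (RNat (ICst 1)))
  (Seq (If (ILt (ICst 0) (ivar pivot))
          (If (RLt (RNat (ICst 0)) (mean (ivar pivot))) Skip
              (rset share (ICst 0)
                 (RDiv (mean (ipred (ivar pivot)))
                       (RSub (mean (ipred (ivar pivot))) (mean (ivar pivot))))))
          Skip)
  (Seq (rset weights (ipred (ivar pivot)) (RSub (RNat (ICst 1)) (rvar share)))
       (rset weights (ivar pivot) (rvar share)))).

Definition round_program : cmd :=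
  Seq tally_program (Seq search_program output_program).

(** * Correctness of the search and of the output weights *)

Section Search.
Variables (R : realType) (N : nat) (m1 : store R).
Hypothesis m1N : ints m1 params 0 2 = N.
Hypothesis m1pivot : ints m1 pivot 0 0 = 0%N.
Hypothesis m1weights : forall j, reals m1 weights j 0 = 0.

Let g (j : nat) : R := reals m1 moments j 0 / (ints m1 visits j 0).+1%:R.

Lemma search_programP :
  let m2 := exec search_program m1 in
  let p := ints m2 pivot 0 0 in
  [/\ ints m2 visits = ints m1 visits, reals m2 = reals m1, (p <= N)%N,
      forall j, (j < p)%N -> 0 < g j & p = N \/ g p <= 0].
Proof.
move=> m2 p; rewrite {}/p {}/m2.
apply: (@exec_For R (fun n m => [/\ ints m visits = ints m1 visits,
  reals m = reals m1, (ints m pivot 0 0 <= n)%N,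
  forall j, (j < ints m pivot 0 0)%N -> 0 < g j &
  ints m pivot 0 0 = n \/ g (ints m pivot 0 0) <= 0])) => //.
  by rewrite m1pivot; split=> //; left.
move=> n m nN [vm rm]; set p := ints m pivot 0 0 => pn gp pE.
rewrite /= /upd /= -/p vm rm addn1 -/(g p).
case: ifPn => [gp0|]; rewrite /upd /=.
  (* A positive value at the pivot rules out that the search has already stopped. *)
  have {}pE : p = n by case: pE => // /le_lt_trans/(_ gp0); rewrite ltxx.
  rewrite addn1 pE; split=> // [j|]; last by left.
  by rewrite ltnS leq_eqVlt => /predU1P[->|]; [rewrite -pE|rewrite -pE; exact: gp].
rewrite -leNgt -/p => gp0; split=> //; last by right.
exact: leqW.
Qed.

Lemma search_outputP :
  exists p, [/\ (p <= N)%N, forall j, (j < p)%N -> 0 < g j, p = N \/ g p <= 0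
    & forall j, reals (exec (Seq search_program output_program) m1) weights j 0
                = mixture (mixing_weight g p) p j].
Proof.
rewrite exec_Seq; have [vm rm] := search_programP.
set m2 := exec search_program m1 in vm rm *; set p := ints m2 pivot 0 0 => pN gp pE.
exists p; split=> // j.
rewrite /output_program !exec_Seq; set m3 := exec _ (exec _ m2).
have [pm3 wm3 sm3] : [/\ ints m3 pivot 0 0 = p,
    forall j, reals m3 weights j 0 = 0 & reals m3 share 0 0 = mixing_weight g p].
  rewrite /m3 /= /upd /= -/p vm rm /mixing_weight.
  rewrite !addn1 !subn1 -!/(g _).
  have w0 i : reals m2 weights i 0 = 0 by rewrite rm.
  by rewrite leNgt; case: (0 < p)%N; case: (0 < g p); rewrite /= /upd /=.
by rewrite /= /upd /= pm3 sm3 wm3 subn1 eqxx !andbT /mixture.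
Qed.

End Search.

(** * Correctness of the tally and of the whole round *)

Section Tally.
Variables (R : realType) (T d N : nat) (x : 'I_T -> 'rV[R]_d) (y : 'I_T -> bool).
Variables (k : 'I_T -> 'I_N.+1) (t : 'I_T).

Let m0 := round_input x y k t.

Let term (s : 'I_T) : R :=
  \sum_(l < d) x s 0 l * x t 0 l * ((y s)%:R - (k s)%:R / N%:R).

Lemma tally_programP :
  let m1 := exec tally_program m0 in
  [/\ ints m1 params = ints m0 params, ints m1 pivot = ints m0 pivot,
      reals m1 weights = reals m0 weights
    & forall j, ints m1 visits j 0 = (\sum_(s < T | (s < t)%N && (k s == j :> nat)) 1)%N
        /\ reals m1 moments j 0 = \sum_(s < T | (s < t)%N && (k s == j :> nat)) term s].
Proof.
have T0 : (0 < T)%N by case: T t => [[]|].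
pose frame m := [/\ ints m params = ints m0 params, ints m labels = ints m0 labels,
  ints m draws = ints m0 draws, ints m pivot = ints m0 pivot
  & reals m contexts = reals m0 contexts /\ reals m weights = reals m0 weights].
pose P n m := frame m /\ forall j,
  ints m visits j 0 = (\sum_(s < T | (s < n)%N && (k s == j :> nat)) 1)%N
  /\ reals m moments j 0 = \sum_(s < T | (s < n)%N && (k s == j :> nat)) term s.
suff : P t (exec tally_program m0) by case=> [[? ? ? ? [_ ?]] ?].
apply: exec_For => //.
  by split=> // j; rewrite !big_pred0.
move=> n m nt [[pm lm dm vm [cm wm]] Hm]; have nT : (n < T)%N by exact: ltn_trans nt _.
pose s := Ordinal nT.
have dn : ints m0 draws n 0 = k s.
  by rewrite /m0 /= nt /= -[n]/(val s) /pad valK.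
have ln : ints m0 labels n 0 = y s.
  by rewrite /m0 /= nt /= -[n]/(val s) /pad valK.
rewrite exec_Seq; set m2 := exec _ (set_int m _ _ _ _).
(* Inside the inner loop the visit of round [n] is already counted, while its product is summed over
   the first [i] coordinates only. The conjunct [true] below gives the sum the shape of
   [big_ordS_cond]. *)
pose Q i m' := [/\ frame m', ints m' counter 0 0 = n,
  forall j, ints m' visits j 0 = (\sum_(s < T | (s < n.+1)%N && (k s == j :> nat)) 1)%N &
  forall j, reals m' moments j 0
    = \sum_(s < T | (s < n)%N && (k s == j :> nat)) term s
      + (if k s == j :> nat then
           \sum_(l < d | (l < i)%N && true) x s 0 l * x t 0 l * ((y s)%:R - (k s)%:R / N%:R)
         else 0)].
suff : Q d (exec (For coordinate (param 1)
            (rset moments draw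
               (RAdd (rcell moments draw)
                  (RMul (RMul (RGet contexts (ivar counter) (ivar coordinate))
                              (RGet contexts (param 3) (ivar coordinate)))
                     (RSub (RNat (icell labels (ivar counter)))
                           (RDiv (RNat draw) (RNat (param 2)))))))) m2).
  move=> [fr _ vs ms]; split=> // j; split; first exact: vs.
  rewrite ms (big_ordS_cond (fun s => k s == j :> nat) term s); congr (_ + _).
  by case: ifP => // _; apply: eq_bigl => l; rewrite ltn_ord.
apply: exec_For => [|| l m' ld [[pm' lm' dm' vm' [cm' wm']] nm' vs ms]].
- by rewrite /m2 /= /upd /= pm.
- split.
  + by split.
  + by [].
  + move=> j; rewrite (big_ordS_cond (fun s => k s == j :> nat) (fun=> 1%N) s) -(Hm j).1.
    rewrite /m2 /= /upd /= dm dn addn1 eqxx !andbT eq_sym.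
    by case: eqP => [<-|_]; [exact/esym/addn1|exact/esym/addn0].
  + move=> j; rewrite -(Hm j).2 big_pred0 // if_same addr0.
    by [].
split.
- by split.
- by [].
- exact: vs.
- move=> j; rewrite (big_ordS_cond predT _ (Ordinal ld)) /=.
  rewrite /upd /= nm' pm' lm' dm' cm' dn ln eqxx !andbT (eq_sym j).
  case: eqP => [<-|/eqP/negbTE kj]; last by rewrite ms kj.
  rewrite ms eqxx -addrA; congr (_ + (_ + _)).
  (* Rows [n] and [t] of the contexts are both revealed in round [t], since [n < t]. *)
  rewrite [ints m0 params]/= /= -[X in (X <= t)%N]/(val s) ltnW //= leqnn.
  rewrite -[n]/(val s) /pad !valK /= -[l]/(val (Ordinal ld)) !valK.
  by [].
Qed.

Lemma round_programP :
  exists (g : nat -> R) (p : nat),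
    [/\ forall j : 'I_N.+1, g j = correlation x y k t j,
        (p <= N)%N, forall j, (j < p)%N -> 0 < g j, p = N \/ g p <= 0
      & forall j, reals (exec round_program m0) weights j 0
                  = mixture (mixing_weight g p) p j].
Proof.
rewrite /round_program exec_Seq.
have [pm vm wm Hm] := tally_programP.
set m1 := exec tally_program m0 in pm vm wm Hm *.
have [||j|p [pN gp pE wE]] := @search_outputP R N m1.
- by rewrite pm.
- by rewrite vm.
- by rewrite wm.
exists (fun j => reals m1 moments j 0 / (ints m1 visits j 0).+1%:R), p; split=> // j.
rewrite (Hm j).1 (Hm j).2 /correlation /count_to /residual dot_suml; congr (_ / _).
apply: eq_bigr => s /andP[_ /eqP/val_inj <-].
by rewrite dotZl /dot mulr_sumr; apply: eq_bigr => l _; rewrite mulrC.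
Qed.

End Tally.

Lemma round_program_cost (R : realType) (T d N : nat) (x : 'I_T -> 'rV[R]_d)
    (y : 'I_T -> bool) (k : 'I_T -> 'I_N.+1) (t : 'I_T) : (N <= T)%N ->
  (cost round_program (round_input x y k t) <= 1000 * (T + d) ^ 2)%N.
Proof.
move=> NT; have tT := ltn_ord t; apply: leq_trans (cost_le (M := T + d) _ _ _) _ => //.
  by move=> [|[|[|[|j]]]] //=; rewrite ?nth_nil //; lia.
by rewrite /=; nia.
Qed.

(** * Harmonic numbers and the function class *)

Section Harmonic.
Variable R : realType.

(** The logarithm grows by [ln (1 + 1 / (n + 1)) <= 1 / (n + 1)] per step. *)
Lemma ln_le_harmonic_sum (n : nat) : ln n.+1%:R <= harmonic_sum R n.
Proof.
elim: n => [|n IH]; first by rewrite ln1 /harmonic_sum big_ord0.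
rewrite /harmonic_sum big_ord_recr /= -/(harmonic_sum R n).
have -> : n.+2%:R = n.+1%:R * (1 + n.+1%:R^-1) :> R.
  by rewrite mulrDr mulr1 divff ?pnatr_eq0 // natr1.
have i0 : 0 < n.+1%:R^-1 :> R by rewrite invr_gt0 ltr0n.
rewrite lnM ?posrE ?ltr0n ?addr_gt0 // lerD // le_ln1Dx //.
by rewrite (lt_trans _ i0) // oppr_lt0.
Qed.

(** With [w = 1 / (n + 2)], the logarithm grows by [- ln (1 - w) >= w] per step. *)
Lemma harmonic_sum_le_ln (n : nat) : harmonic_sum R n.+1 <= 1 + ln n.+1%:R.
Proof.
elim: n => [|n IH]; first by rewrite ln1 /harmonic_sum big_ord1 invr1 addr0.
rewrite /harmonic_sum big_ord_recr /= -/(harmonic_sum R n.+1).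
have u0 : 0 < n.+2%:R :> R by rewrite ltr0n.
have v0 : 0 < n.+1%:R :> R by rewrite ltr0n.
have -> : n.+2%:R = n.+1%:R / (1 + - n.+2%:R^-1) :> R.
  have -> : 1 + - n.+2%:R^-1 = n.+1%:R / n.+2%:R :> R.
    by rewrite -[n.+2%:R]natr1 in u0 *; field; rewrite gt_eqF.
  by field; rewrite !gt_eqF.
set w : R := n.+2%:R^-1.
have w1 : w < 1 by rewrite invf_lt1 // ltr1n.
have w0 : 0 < 1 + - w by rewrite subr_gt0.
have := le_ln1Dx (_ : -1 < - w); rewrite ltrN2 => /(_ w1) H.
rewrite lnM ?posrE ?invr_gt0 // lnV ?posrE //.
have -> : (n.+1%:R / (1 - w))^-1 = w.
  rewrite (_ : 1 - w = n.+1%:R / n.+2%:R).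
    by rewrite /w; field; rewrite !gt_eqF.
  by rewrite /w -[n.+2%:R]natr1 in u0 *; field; rewrite gt_eqF.
lra.
Qed.

Lemma ln2_ge : 1 / 2 <= ln 2%:R :> R.
Proof.
have := @le_ln1Dx R (- 2^-1); rewrite (_ : 1 + _ = 2^-1); last by field.
by rewrite lnV ?posrE //; lra.
Qed.

Lemma ln_nat_ge (n : nat) : (2 <= n)%N -> 1 / 2 <= ln n%:R :> R.
Proof.
move=> n2; apply: le_trans ln2_ge _.
by rewrite ler_ln ?posrE ?ltr0n ?(ltn_trans _ n2) // ler_nat.
Qed.

Lemma harmonic_sum_ln (n : nat) : (2 <= n)%N ->
  ln n%:R <= harmonic_sum R n <= 3 * ln n%:R.
Proof.
case: n => [//|n] n2; apply/andP; split.
  by rewrite (le_trans (ln_le_harmonic_sum n)) // harmonic_sum_le.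
(* The additive 1 is at most [2 ln n], as [ln n >= 1 / 2]. *)
by have := ln_nat_ge n2; have := harmonic_sum_le_ln n; lra.
Qed.

Lemma harmonic_sum_ge1 (n : nat) : (0 < n)%N -> 1 <= harmonic_sum R n.
Proof.
move=> n0; rewrite (le_trans _ (harmonic_sum_le R n0)) //.
by rewrite /harmonic_sum big_ord1 invr1.
Qed.

End Harmonic.

(** Two contexts suffice: first coordinate [1 / 2], the rest of length at most [1 / 2] along plus or
    minus the tail of [theta]. If [r] is the length of the tail, the values are [(theta_0 + r) / 2]
    and [(theta_0 - r) / 2], and their squares sum to half of [dot theta theta]. *)
Lemma F1_lin_dot (R : realType) (d : nat) (theta : 'rV[R]_d) : (0 < d)%N ->
  @F1_lin R d (fun x => dot theta x) -> dot theta theta <= 4.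
Proof.
move=> d0 [_ f1]; pose i0 := Ordinal d0.
pose r2 := \sum_(i < d | i != i0) theta 0 i ^+ 2; pose r := Num.sqrt r2.
have r20 : 0 <= r2 by apply: sumr_ge0 => i _; exact: sqr_ge0.
have rr : r ^+ 2 = r2 by rewrite sqr_sqrtr.
(* For [r = 0] the quotient is 0 by convention, hence an inequality. *)
have r1 : r * (2 * r)^-1 <= 1 / 2 /\ r2 * (2 * r)^-1 = r / 2.
  rewrite -rr; have [->|r0] := eqVneq r 0; first by rewrite expr0n !mul0r; lra.
  by split; [rewrite le_eqVlt; apply/orP; left; apply/eqP|]; field.
have r0 : 0 <= r * (2 * r)^-1 by rewrite divr_ge0 ?mulr_ge0 ?sqrtr_ge0.
pose v (s : R) : 'rV[R]_d :=
  \row_i (if i == i0 then 1 / 2 else s * theta 0 i * (2 * r)^-1).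
have dv s : dot theta (v s) = theta 0 i0 / 2 + s * (r / 2).
  rewrite /dot (bigD1 i0) //= mxE eqxx mul1r; congr (_ + _).
  rewrite -r1.2 [r2 * _]mulr_suml mulr_sumr; apply: eq_bigr => i i_i0.
  by rewrite mxE (negbTE i_i0); ring.
have vX s : s ^+ 2 = 1 -> context_space (v s).
  move=> s2; split; last first.
    move=> i i0'; rewrite mxE (_ : i == i0) //; exact/eqP/val_inj.
  rewrite /norm2 -sqrtr1 ler_wsqrtr // /dot (bigD1 i0) //= mxE eqxx.
  rewrite (_ : \sum_(i < d | i != i0) _ = (r * (2 * r)^-1) ^+ 2).
    by case: r1 => r1 _; nra.
  rewrite exprMn rr mulr_suml; apply: eq_bigr => i i_i0.
  rewrite mxE (negbTE i_i0) -expr2 exprMn; congr (_ * _).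
  by rewrite exprMn s2 mul1r.
have -> : dot theta theta = theta 0 i0 ^+ 2 + r2.
  by rewrite /dot (bigD1 i0) //= -expr2; congr (_ + _); apply: eq_bigr => i _; rewrite expr2.
have := f1 _ (vX 1 (expr1n _ _)); have := f1 _ (vX (-1) (etrans (sqrrN 1) (expr1n _ _))).
by rewrite -rr !dv; nra.
Qed.

Lemma context_space_dot (R : realType) (d : nat) (x : 'rV[R]_d) :
  context_space x -> dot x x <= 1.
Proof.
move=> [x1 _]; rewrite -[leLHS]sqr_sqrtr ?dot_ge0 //.
by rewrite exprn_ile1 ?sqrtr_ge0.
Qed.

(** For a linear [f], [rho] is the product of [theta] with the residual over the count, and
    Cauchy-Schwarz with [dot theta theta <= 4] bounds its square. *)
Lemma SMCal_le (R : realType) (T d N : nat) (x : 'I_T -> 'rV[R]_d)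
    (y : 'I_T -> bool) (k : 'I_T -> 'I_N.+1) : (0 < d)%N -> (0 < N)%N ->
  (SMCal N (@F1_lin R d) 2%:R x y (fun t => grid R (k t))
   <= (4 * \sum_j potential x y k j)%:E)%E.
Proof.
move=> d0 N0; rewrite mulr_sumr -sumEFin /SMCal; apply: lee_sum => j _.
have gridE (i : 'I_N.+1) : (grid R i == grid R j) = (i == j).
  apply/eqP/eqP => [/divIf gij|-> //]; apply/val_inj/eqP.
  by rewrite -(eqr_nat R) gij // pnatr_eq0 -lt0n.
have -> : hits (fun t => grid R (k t)) (grid R j) = count_to k T j.
  rewrite /hits /count_to [RHS]big_mkcond /=; apply: eq_bigr => t _.
  by rewrite gridE ltn_ord; case: (k t == j).
(* For a grid point never predicted both sides are 0, whatever the supremum. *)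
have [n0|n0] := eqVneq (count_to k T j) 0%N.
  by rewrite /potential n0 mul0e invr0 !mulr0.
have {}n0 : 0 < (count_to k T j)%:R :> R by rewrite ltr0n lt0n.
pose B : R := 4 * dot (residual x y k T j) (residual x y k T j) / (count_to k T j)%:R ^+ 2.
apply: (@le_trans _ _ ((count_to k T j)%:R%:E * B%:E)%E); last first.
  rewrite -EFinM lee_fin /B /potential le_eqVlt; apply/orP; left; apply/eqP.
  by field; rewrite gt_eqF.
apply: lee_wpmul2l; first by rewrite lee_fin ltW.
apply: ge_ereal_sup => _ [f F1f <-]; rewrite lee_fin.
have [[theta fE] _] := F1f; rewrite fE in F1f *.
rewrite powR_mulrn // real_normK ?num_real //.
have -> : rho x y (fun t => grid R (k t)) (grid R j) (fun u => dot theta u)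
    = dot theta (residual x y k T j) / (count_to k T j)%:R.
  rewrite /rho; congr (_ / _).
    rewrite dotC /residual dot_suml; apply: eq_big => [t|t _].
      by rewrite gridE ltn_ord.
    by rewrite dotZl mulrC dotC.
  rewrite /hits /count_to; congr (_%:R); rewrite [RHS]big_mkcond /=; apply: eq_bigr => t _.
  by rewrite gridE ltn_ord; case: (k t == j).
rewrite expr_div_n /B ler_pM2r ?invr_gt0 ?exprn_gt0 //.
apply: le_trans (Cauchy_Schwarz _ _) _.
by rewrite ler_wpM2r ?dot_ge0 // F1_lin_dot.
Qed.

(** Markov's inequality for [expR (c * Z i)], which exceeds [1 / delta] outside [E]. *)
Lemma prob_ge_of_expR (R : realType) (I : finType) (P Z : I -> R) (E : pred I)
    (c delta : R) : 0 < c -> 0 < delta ->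
  (forall i, 0 <= P i) -> \sum_i P i = 1 ->
  \sum_i P i * expR (c * Z i) <= 1 ->
  (forall i, c * Z i <= ln (1 / delta) -> E i) ->
  1 - delta <= prob P E.
Proof.
move=> c0 delta0 P0 P1 PZ ZE; rewrite -P1 (bigID E) /= -/(prob P E).
rewrite -addrA gerDl subr_le0.
have PZ0 i : 0 <= P i * expR (c * Z i) by rewrite mulr_ge0 ?expR_ge0.
apply: (@le_trans _ _ (delta * \sum_i P i * expR (c * Z i))); last first.
  by rewrite ler_piMr // ltW.
rewrite [in leRHS](bigID E) /= mulrDr -[leLHS]add0r lerD ?mulr_ge0 ?sumr_ge0 ?(ltW delta0) //.
rewrite mulr_sumr ler_sum // => i nEi; rewrite mulrCA ler_peMr //.
rewrite -ler_pdivrMl // mulr1 -[delta^-1]lnK ?posrE ?invr_gt0 // ler_expR -div1r.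
by rewrite ltW // ltNge; apply: contra nEi => /ZE.
Qed.

(** * The forecaster *)

Section Algorithm.
Variable R : realType.

Definition forecaster : algorithm := Algorithm setup_program round_program.

Lemma grid_sizeP (T d : nat) : (2 <= T)%N -> (1 <= d)%N ->
  let N := grid_size R forecaster T d in
  let K : R := d%:R * harmonic_sum R T in
  [/\ (0 < N <= T)%N, N = 1%N \/ N%:R ^+ 3 * K <= T%:R & T%:R < N.+1%:R ^+ 3 * K].
Proof.
move=> T2 d1; apply: setup_programP; first exact: ltnW.
by rewrite -[leLHS]mulr1 ler_pM ?ler1n ?harmonic_sum_ge1 // ltnW.
Qed.

Lemma forecaster_efficient : efficient R forecaster.
Proof.
exists 2000%N, 3%N => T d T2 d1 x y k _.
have [/andP[N0 NT] _ _] := grid_sizeP T2 d1; rewrite /running_time.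
set N := grid_size R forecaster T d in k N0 NT *.
have H : (\sum_(t < T) (cost round_program (round_input x y k t) + N.+1)
          <= T * (1000 * (T + d) ^ 2 + T.+1))%N.
  rewrite -[X in (_ <= X * _)%N](card_ord T) -sum_nat_const.
  by apply: leq_sum => t _; rewrite leq_add // round_program_cost.
apply: leq_trans (leq_add (setup_program_cost R d (ltnW T2)) H) _.
have sT : (T <= T + d)%N by rewrite leq_addr.
have s0 : (0 < T + d)%N by rewrite (leq_trans (ltnW T2)).
move: (T + d)%N sT s0 => s sT s0.
apply: (@leq_trans (100 * s + s * (1000 * s ^ 2 + s.+1))).
  by rewrite leq_add2l leq_mul // leq_add2l.
by rewrite !expnS expn0; nia.
Qed.

Section Play.
Variables (T d N : nat) (x : 'I_T -> 'rV[R]_d) (y : 'I_T -> bool).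
Hypothesis N0 : (0 < N)%N.
Hypothesis x1 : forall t, dot (x t) (x t) <= 1.
Implicit Types k : {ffun 'I_T -> 'I_N.+1}.

Lemma forecastP k t :
  is_distribution (forecast forecaster x y k t)
  /\ balanced (y t)%:R (forecast forecaster x y k t) (correlation x y k t).
Proof.
have [g [p [gE pN gp pE wE]]] := round_programP x y k t.
have -> : forecast forecaster x y k t = (fun j : 'I_N.+1 => mixture (mixing_weight g p) p j).
  by apply/funext => j; exact: wE.
have -> : correlation x y k t = (fun j : 'I_N.+1 => g j) by apply/funext => j; rewrite gE.
by split; [exact: mixture_distribution|exact: mixture_balanced].
Qed.

Lemma forecast_past (t : 'I_T) k k' : (forall s : 'I_T, (s < t)%N -> k s = k' s) ->
  forecast forecaster x y k t = forecast forecaster x y k' t.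
Proof.
move=> kk'; apply/funext => j; rewrite /forecast; congr (reals (exec _ _) _ _ _).
rewrite /round_input; congr Store; apply/funext => a; apply/funext => i; apply/funext => l.
case: ifP => // _; case: ifP => // _; case: ifP => // /and3P[_ it _].
by rewrite /pad; case: insubP => // s _ si; rewrite kk' // si.
Qed.

Lemma correlation_past (t : 'I_T) k k' j : (forall s : 'I_T, (s < t)%N -> k s = k' s) ->
  correlation x y k t j = correlation x y k' t j.
Proof.
move=> kk'; rewrite /correlation /residual /count_to.
have kE (s : 'I_T) : (s < t)%N && (k s == j) = (s < t)%N && (k' s == j).
  by case: ltnP => // /kk' ->.
by rewrite (eq_bigl _ _ kE) [X in X.+1%:R](eq_bigl _ _ kE).
Qed.

(** Each round subtracts the discretization allowance that makes its conditional exponential moment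
    at most 1. *)
Definition excess k : R := \sum_t (gain x y k t (k t) - (2 * N%:R ^+ 2)^-1).

Lemma draws_prob_ge0 k : 0 <= draws_prob forecaster x y k.
Proof. by apply: prodr_ge0 => t _; exact: (forecastP k t).1.1. Qed.

Let upd_past (t : 'I_T) k j (s : 'I_T) : (s < t)%N -> ffun_upd k t j s = k s.
Proof. by rewrite ffunE; case: eqP => // ->; rewrite ltnn. Qed.

Lemma sum_draws_prob : \sum_(k : {ffun 'I_T -> 'I_N.+1}) draws_prob forecaster x y k = 1.
Proof.
rewrite (@sum_kernels_eq1 R T _ ord0 (fun t k => forecast forecaster x y k t (k t))) //.
  move=> t k k' kk'; rewrite (@forecast_past t k k') ?kk' // => s st.
  by rewrite kk' // ltnW.
move=> t k; rewrite -(forecastP k t).1.2; apply: eq_bigr => j _.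
rewrite (forecast_past (@upd_past t k j)) ffunE eqxx.
by [].
Qed.

(** The weighted exponential factors over rounds, and [expR_gain_le1] bounds the conditional mean of
    each factor. *)
Lemma sum_draws_prob_expR :
  \sum_(k : {ffun 'I_T -> 'I_N.+1}) draws_prob forecaster x y k * expR (36^-1 * excess k) <= 1.
Proof.
pose a (t : 'I_T) k := forecast forecaster x y k t (k t)
  * expR (36^-1 * (gain x y k t (k t) - (2 * N%:R ^+ 2)^-1)).
rewrite (eq_bigr (fun k => \prod_(t < T) a t k)); last first.
  by move=> k _; rewrite mulr_sumr expR_sum -big_split.
apply: (@sum_kernels_le1 R T _ ord0 a) => [t k k' kk'|t k|t k].
- have kk'' (s : 'I_T) : (s < t)%N -> k s = k' s by move=> st; rewrite kk' // ltnW.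
  by rewrite /a /gain (forecast_past kk'') (correlation_past _ kk'') kk'.
- by rewrite mulr_ge0 ?expR_ge0 //; exact: (forecastP k t).1.1.
have [dist bal] := forecastP k t.
apply: le_trans (expR_gain_le1 N0 dist (norm_correlation_le1 y k x1 N0 t) bal).
rewrite le_eqVlt; apply/orP; left; apply/eqP/eq_bigr => j _.
rewrite /a /gain (forecast_past (@upd_past t k j)) ffunE eqxx.
by rewrite (correlation_past _ (@upd_past t k j)).
Qed.

(** Since [1 + u <= expR u], the exponential moment bound also controls the mean. *)
Lemma sum_draws_prob_excess :
  \sum_(k : {ffun 'I_T -> 'I_N.+1}) draws_prob forecaster x y k * excess k <= 0.
Proof.
have := sum_draws_prob_expR; rewrite -[leRHS]sum_draws_prob => H.
have : \sum_(k : {ffun 'I_T -> 'I_N.+1}) draws_prob forecaster x y k * (1 + 36^-1 * excess k)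
    <= \sum_(k : {ffun 'I_T -> 'I_N.+1}) draws_prob forecaster x y k.
  apply: le_trans H; apply: ler_sum => k _.
  by rewrite ler_wpM2l ?draws_prob_ge0 ?expR_ge1Dx.
under eq_bigr do rewrite mulrDr mulr1 mulrCA.
by rewrite big_split /= gerDl -mulr_sumr pmulr_rle0 ?invr_gt0.
Qed.

End Play.
End Algorithm.

(** * From the potential to the rates *)

Lemma expectation_fin_le (R : realType) (I : finType) (P B : I -> R)
    (Z : I -> \bar R) (c : R) :
  (forall i, 0 <= P i) -> (forall i, (Z i <= (B i)%:E)%E) ->
  \sum_i P i * B i <= c -> (expectation_fin P Z <= c%:E)%E.
Proof.
move=> P0 ZB Bc; apply: (@le_trans _ _ (\sum_i P i * B i)%:E); last by rewrite lee_fin.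
rewrite -sumEFin; apply: lee_sum => i _.
by rewrite EFinM lee_wpmul2l // lee_fin.
Qed.

Lemma powR_third (R : realType) (u : R) : 0 <= u -> (u `^ (1 / 3)) ^+ 3 = u.
Proof.
move=> u0; rewrite -powR_mulrn ?powR_ge0 // -powRrM.
by rewrite (_ : 1 / 3 * 3 = 1) ?powRr1 //; field.
Qed.

Lemma powR_two_thirds (R : realType) (u : R) :
  0 <= u -> u `^ (2 / 3) = (u `^ (1 / 3)) ^+ 2.
Proof.
move=> u0; rewrite -powR_mulrn ?powR_ge0 // -powRrM.
by congr (_ `^ _); field.
Qed.

(* Here [a ^+ 3 = T], [b ^+ 3 = d * ln T], [h] is the harmonic number and
   [K = d * h]. *)
Lemma grid_rate (R : realType) (a b h K : R) (N : nat) :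
  0 < a -> 0 < b -> (0 < N)%N -> b ^+ 3 <= K <= 3 * b ^+ 3 -> h <= 3 * b ^+ 3 ->
  N = 1%N \/ N%:R ^+ 3 * K <= a ^+ 3 -> a ^+ 3 < N.+1%:R ^+ 3 * K ->
  K <= a ^+ 3 ->
  a ^+ 3 * (2 * N%:R ^+ 2)^-1 + N.+1%:R * h <= 21 / 2 * (a * b ^+ 2) /\ b <= a.
Proof.
move=> a0 b0 N0 /andP[bK Kb] hb N1 aN Ka.
set n : R := N%:R; have n1 : 1 <= n by rewrite ler1n.
have n0 : 0 < n by exact: lt_le_trans n1.
have K0 : 0 < K by exact: lt_le_trans (exprn_gt0 3 b0) bK.
have leX (u v : R) : 0 <= u -> 0 <= v -> u ^+ 3 <= v ^+ 3 -> u <= v.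
  by move=> u0 v0; rewrite ler_pXn2r ?nnegrE.
have nb : n * b <= a.
  apply: leX; [by rewrite mulr_ge0 ?ltW|exact: ltW|rewrite exprMn].
  apply: (@le_trans _ _ (n ^+ 3 * K)); first by rewrite ler_wpM2l // exprn_ge0 // ltW.
  by case: N1 => // NE; rewrite /n NE expr1n mul1r.
(* With [N + 1 <= 2 n] and [K <= 3 b ^ 3], [a ^ 3] is at most [24 (n b) ^ 3], below
   [27 (n b) ^ 3]. *)
have an : a <= 3 * (n * b).
  apply: leX; [exact: ltW|by rewrite !mulr_ge0 ?ltW|].
  apply: (le_trans (ltW aN)); rewrite -natr1 -/n.
  apply: (@le_trans _ _ ((2 * n) ^+ 3 * (3 * b ^+ 3))).
    rewrite ler_pM ?exprn_ge0 ?(ltW K0) ?addr_ge0 ?(ltW n0) //.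
    by rewrite lerXn2r ?nnegrE ?mulr_ge0 ?addr_ge0 ?(ltW n0) //; lra.
  have : 0 <= (n * b) ^+ 3 by rewrite exprn_ge0 // mulr_ge0 // ltW.
  rewrite !exprMn; lra.
split; last by apply: le_trans nb; rewrite ler_peMl // ltW.
have t1 : a ^+ 3 * (2 * n ^+ 2)^-1 <= 9 / 2 * (a * b ^+ 2).
  rewrite ler_pdivrMr ?mulr_gt0 ?exprn_gt0 //.
  have : a ^+ 2 <= (3 * (n * b)) ^+ 2.
    by rewrite lerXn2r ?nnegrE ?mulr_ge0 ?(ltW a0) ?(ltW n0) ?(ltW b0).
  rewrite -(ler_pM2l a0); rewrite !exprMn => H.
  rewrite exprS; apply: le_trans H _; rewrite le_eqVlt; apply/orP; left; apply/eqP.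
  by field.
have t2 : N.+1%:R * h <= 6 * (a * b ^+ 2).
  rewrite -natr1 -/n; apply: (@le_trans _ _ ((2 * n) * (3 * b ^+ 3))).
    apply: (@le_trans _ _ ((n + 1) * (3 * b ^+ 3))).
      by rewrite ler_wpM2l // addr_ge0 // ltW.
    by rewrite ler_wpM2r ?mulr_ge0 ?exprn_ge0 ?(ltW b0) //; lra.
  have : (n * b) * b ^+ 2 <= a * b ^+ 2 by rewrite ler_wpM2r // exprn_ge0 // ltW.
  rewrite (exprS b 2); lra.
rewrite -/n; lra.
Qed.

Theorem theorem1 (R : realType) :
  exists C : R, 0 < C /\
  exists A : algorithm, efficient R A /\
  forall T d : nat, (2 <= T)%N -> (1 <= d)%N ->
  let N := grid_size R A T d in
  (0 < N)%N /\
  forall (x : 'I_T -> 'rV[R]_d) (y : 'I_T -> bool),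
  (forall t, context_space (x t)) ->
  let P := draws_prob A x y : {ffun 'I_T -> 'I_N.+1} -> R in
  let err (k : {ffun 'I_T -> 'I_N.+1}) : \bar R :=
    SMCal N (@F1_lin R d) 2%:R x y (fun t => grid R (k t)) in
  let rate : R :=
    T%:R `^ (1 / 3%:R) * d%:R `^ (2%:R / 3%:R) * ln T%:R `^ (2%:R / 3%:R) in
  [/\ forall (k : {ffun 'I_T -> 'I_N.+1}) (t : 'I_T),
        is_distribution (forecast A x y k t),
      forall delta : R, 0 < delta < 1 ->
        1 - delta <=
        prob P (fun k =>
          (err k <= (C * (rate + (T%:R / (d%:R * ln T%:R)) `^ (1 / 3%:R)
                                 * ln (1 / delta)))%:E)%E)
    & (expectation_fin P err <= (C * rate)%:E)%E].
Proof.
(* [144 = 4 * 36]: the factor of [SMCal_le] times the tail scale of the excess. It also covers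
   [42 = 4 * 21 / 2] from [grid_rate], and 16 from the trivial bound. *)
exists 144; split=> //; exists forecaster; split; first exact: forecaster_efficient.
move=> T d T2 d1 N; have [/andP[N0 NT] N1 NK] := grid_sizeP R T2 d1.
split=> // x y xX P err rate.
have x1 t : dot (x t) (x t) <= 1 by exact: context_space_dot.
have L0 : 0 < ln T%:R :> R by apply: lt_le_trans (ln_nat_ge R T2).
have T0 : 0 < T%:R :> R by rewrite ltr0n ltnW.
have d0 : 1 <= d%:R :> R by rewrite ler1n.
have dL0 : 0 < d%:R * ln T%:R :> R by rewrite mulr_gt0 // (lt_le_trans _ d0).
pose a : R := T%:R `^ (1 / 3); pose b : R := (d%:R * ln T%:R) `^ (1 / 3).
have a3 : a ^+ 3 = T%:R by rewrite powR_third // ltW.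
have b3 : b ^+ 3 = d%:R * ln T%:R by rewrite powR_third // ltW.
have a0 : 0 < a by rewrite powR_gt0.
have b0 : 0 < b by rewrite powR_gt0.
have rateE : rate = a * b ^+ 2.
  by rewrite /rate -mulrA -powRM ?(ltW L0) // powR_two_thirds ?(ltW dL0).
have abE : (T%:R / (d%:R * ln T%:R)) `^ (1 / 3%:R) = a / b.
  rewrite powRM ?invr_ge0 ?(ltW dL0) //; congr (_ * _).
  apply: (@mulfI _ b); first by rewrite gt_eqF.
  rewrite {1}/b -powRM ?invr_ge0 ?(ltW dL0) // !divff ?gt_eqF //.
  by rewrite powR1.
have rate0 : 0 <= rate by rewrite rateE mulr_ge0 ?exprn_ge0 // ltW.
have /andP[hL Lh] := harmonic_sum_ln R T2.
set h : R := harmonic_sum R T in N1 NK hL Lh.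
set K : R := d%:R * h in N1 NK.
have bK : b ^+ 3 <= K <= 3 * b ^+ 3.
  rewrite b3 /K; apply/andP; split; first by rewrite ler_wpM2l.
  by rewrite mulrCA ler_wpM2l.
have hb : h <= 3 * b ^+ 3.
  by rewrite b3 (le_trans Lh) // ler_pM2l // ler_peMl // ltW.
have dist (k : {ffun 'I_T -> 'I_N.+1}) t : is_distribution (forecast forecaster x y k t).
  exact: (forecastP x y N0 k t).1.
have P0 k : 0 <= P k by exact: draws_prob_ge0.
have P1 : \sum_k P k = 1 by exact: sum_draws_prob.
have PZ := sum_draws_prob_expR y N0 x1.
pose Z (k : {ffun 'I_T -> 'I_N.+1}) := excess x y k.
have log0 delta : 0 < delta < 1 -> 0 <= ln (1 / delta) :> R.
  by case/andP=> delta0 delta1; rewrite ln_ge0 // div1r ltW // invf_gt1.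
have [KT|TK] := leP K (a ^+ 3).
  have [] := grid_rate a0 b0 N0 bK hb _ _ KT; rewrite ?a3 // -rateE => bound ba.
  have errZ k : (err k <= (42 * rate + 4 * Z k)%:E)%E.
    apply: le_trans (SMCal_le x y k d1 N0) _; rewrite lee_fin.
    have ZE : Z k = \sum_t gain x y k t (k t) - T%:R * (2 * N%:R ^+ 2)^-1.
      by rewrite /Z /excess big_split /= sumr_const card_ord mulNrn -[_ *+ T]mulr_natl.
    have := sum_potential_le y k x1 N0; rewrite -/h; lra.
  split=> // [delta delta01|].
    have [delta0 _] := andP delta01.
    apply: (prob_ge_of_expR (c := 36^-1) _ delta0 P0 P1 PZ) => // k Zk.
    apply: le_trans (errZ k) _; rewrite lee_fin abE.
    (* The tail has constant scale, and [b <= a] lets the factor [a / b] of the claim absorb it. *)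
    have ab1 : 1 <= a / b by rewrite ler_pdivlMr // mul1r.
    have : ln (1 / delta) <= a / b * ln (1 / delta) by rewrite ler_peMl ?log0.
    rewrite -/(Z k) in Zk; lra.
  apply: expectation_fin_le P0 errZ _.
  under eq_bigr do rewrite mulrDr.
  rewrite big_split /= -mulr_suml P1 mul1r.
  under [X in _ + X <= _]eq_bigr do rewrite mulrCA.
  rewrite -mulr_sumr; have := sum_draws_prob_excess y N0 x1; rewrite -/P -/Z => H.
  by rewrite -/(Z _) in H *; lra.
(* Now [a ^ 3 < K <= 3 b ^ 3], so [a <= 2 b] and [T = a ^ 3 <= 4 a b ^ 2]: the bound holds for every
   sequence of draws. *)
have errT k : (err k <= (144 * rate)%:E)%E.
  apply: le_trans (SMCal_le x y k d1 N0) _; rewrite lee_fin.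
  have := sum_potential_leT y k x1 N0; rewrite -a3 => H.
  suff : a ^+ 3 <= 4 * rate by lra.
  have ab : a <= 2 * b.
    have : a ^+ 3 <= (2 * b) ^+ 3.
      by rewrite exprMn; have /andP[_] := bK; have := exprn_gt0 3 b0; lra.
    by rewrite ler_pXn2r ?nnegrE ?mulr_ge0 // ltW.
  have : a ^+ 2 <= (2 * b) ^+ 2 by rewrite ler_pXn2r ?nnegrE ?mulr_ge0 // ltW.
  by rewrite exprS rateE -(ler_pM2l a0) exprMn; lra.
split=> // [delta delta01|].
  have [delta0 _] := andP delta01.
  apply: (prob_ge_of_expR (c := 36^-1) _ delta0 P0 P1 PZ) => // k _.
  apply: le_trans (errT k) _; rewrite lee_fin abE ler_wpM2l // lerDl.
  by rewrite mulr_ge0 ?log0 // divr_ge0 // ltW.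
apply: expectation_fin_le P0 errT _.
by rewrite -mulr_suml P1 mul1r.
Qed.
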